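(* Let $D$ be a Dedekind domain with infinitely many maximal ideals, all of them of finite index, and let $K$ be its quotient field. Let $n\ge 1$ and let $1\le m_1\le m_2\le\cdots\le m_n$ be natural numbers. Then there exists a polynomial $H\in \operatorname{Int}(D)$ which has exactly $n$ essentially different factorizations into irreducible elements of $\operatorname{Int}(D)$, the lengths of these factorizations being $m_1+1,\ldots,m_n+1$.
   Context: $\operatorname{Int}(D)=\{f\in K[x]\mid f(D)\subseteq D\}$ is the ring of integer-valued polynomials on $D$. A maximal ideal $P$ has finite index if $D/P$ is finite. An element $r$ of a commutative ring $R$ is irreducible if it is a non-zero non-unit that is not a product of two non-units. A factorization of $r$ is an expression $r=a_1\cdots a_k$ with $k\ge1$ and all $a_i$ irreducible; $k$ is its length. Two factorizations $r=a_1\cdots a_k=b_1\cdots b_l$ are essentially the same if $k=l$ and, after reindexing, $a_j=u_jb_j$ with $u_j$ a unit of $R$ for all $j$; otherwise they are essentially different. *)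

(* Defs.v *)
From HB Require Import structures.
From mathcomp Require Import all_boot all_order all_algebra all_fingroup.
From mathcomp Require Export fraction.
Set Implicit Arguments. Unset Strict Implicit. Unset Printing Implicit Defensive.
Import Order.TTheory GRing.Theory Num.Theory.
Local Open Scope ring_scope.

Definition is_ideal (R : comRingType) (I : R -> Prop) : Prop :=
  [/\ I 0, (forall x y, I x -> I y -> I (x - y)) & (forall a x, I x -> I (a * x))].

Definition ideal_fin_gen (R : comRingType) (I : R -> Prop) : Prop :=
  exists s : seq R, forall x,
    I x <-> exists c : 'I_(size s) -> R, x = \sum_(i < size s) c i * s`_i.

Definition noetherian (R : comRingType) : Prop :=
  forall I : R -> Prop, is_ideal I -> ideal_fin_gen I.

Definition prime_ideal (R : comRingType) (P : R -> Prop) : Prop :=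
  [/\ is_ideal P, ~ P 1 & forall x y, P (x * y) -> P x \/ P y].

Definition maximal_ideal (R : comRingType) (M : R -> Prop) : Prop :=
  [/\ is_ideal M, ~ M 1 &
    forall J : R -> Prop, is_ideal J -> (forall x, M x -> J x) ->
      (forall x, J x -> M x) \/ J 1].

Definition dim_le1 (R : comRingType) : Prop :=
  forall P : R -> Prop, prime_ideal P -> (exists x, P x /\ x <> 0) -> maximal_ideal P.

Definition integrally_closed (D : idomainType) : Prop :=
  forall (p : {poly D}) (z : {fraction D}),
    p \is monic -> root (map_poly (@FracField.tofrac D) p) z ->
    exists d : D, z = FracField.tofrac d.

Definition dedekind (D : idomainType) : Prop :=
  [/\ noetherian D, integrally_closed D & dim_le1 D].

Definition finite_index (R : comRingType) (P : R -> Prop) : Prop :=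
  exists s : seq R, forall x, exists2 y, y \in s & P (x - y).

Definition infinitely_many_maximal (R : comRingType) : Prop :=
  forall n : nat, exists M : 'I_n -> (R -> Prop),
    (forall i, maximal_ideal (M i)) /\
    (forall i j, i != j -> ~ (forall x, M i x <-> M j x)).

Definition intD (D : idomainType) (f : {poly {fraction D}}) : Prop :=
  forall d : D, exists e : D, f.[FracField.tofrac d] = FracField.tofrac e.

Definition unitInt (D : idomainType) (f : {poly {fraction D}}) : Prop :=
  intD f /\ exists g, intD g /\ f * g = 1.

Definition irredInt (D : idomainType) (r : {poly {fraction D}}) : Prop :=
  [/\ intD r, r <> 0, ~ unitInt r &
    forall a b, intD a -> intD b -> r = a * b -> unitInt a \/ unitInt b].

Definition factorizationInt (D : idomainType) (r : {poly {fraction D}})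
    (F : seq {poly {fraction D}}) : Prop :=
  [/\ (0 < size F)%N, (forall a, a \in F -> irredInt a) & r = \prod_(a <- F) a].

Definition ess_same (D : idomainType) (F G : seq {poly {fraction D}}) : Prop :=
  size F = size G /\
  exists2 G', perm_eq G' G &
    forall j, (j < size F)%N -> exists2 u, unitInt u & F`_j = u * G'`_j.

(* Main.v *)
(* Let [V] be the disjoint union of blocks [V_k] with [#|V_k| = m k], viewed as
   the vertices of a complete [n]-partite graph. Attach distinct maximal ideals
   [P_e] to the pairs [e] of vertices, pick [c <> 0] in all of them, and take
   linear polynomials [f_v = b_v + (1 - b_v) X] where [b_v = 0] mod [P_e] if [v]
   is an end of [e] and [b_v = 1] mod [P_e] otherwise. A polynomial
   [s], Eisenstein at a further maximal ideal and with [s(1) = c],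
   is built so that [s] kills [D/cD] except for one obstruction at each edge
   [e], located at the residue class [0] of [P_e]; the factor [f_v] removes the
   obstruction at [e] exactly when [v] is an end of [e]. Thus
   [s * \prod_(v in J) f_v / c] is integer-valued iff [J] is a vertex cover,
   i.e. iff the complement of [J] lies in a single block. All of [s / c] and
   [f_v] take the value [1] at [1], so constants appearing in factorizations of
   [H = s * \prod_v f_v / c] are units, and the factorizations of [H] correspond
   to the minimal vertex covers [V \ V_k]: one factor [s * \prod_(v in J) f_v / c]
   and the [m k] linear factors [f_v] for [v] in [V_k]. *)
Require Import Defs.
From HB Require Import structures.
From mathcomp Require Import all_boot all_order all_algebra all_fingroup.
From mathcomp Require Import fraction.
From mathcomp Require Import boolp ring zify.
Set Implicit Arguments. Unset Strict Implicit. Unset Printing Implicit Defensive.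
Import Order.TTheory GRing.Theory Num.Theory.
Local Open Scope ring_scope.

(** * Ideals, maximal ideals and the maximum principle of noetherian rings *)

Section Ideals.
Variable D : comNzRingType.
Implicit Types (I J P : D -> Prop) (a b x y : D).

Lemma ideal0 I : is_ideal I -> I 0. Proof. by case. Qed.

Lemma idealB I x y : is_ideal I -> I x -> I y -> I (x - y).
Proof. by case=> _ + _; apply. Qed.

Lemma idealMl I a x : is_ideal I -> I x -> I (a * x).
Proof. by case=> _ _; apply. Qed.

Lemma idealMr I a x : is_ideal I -> I x -> I (x * a).
Proof. by rewrite mulrC; apply: idealMl. Qed.

Lemma idealN I x : is_ideal I -> I x -> I (- x).
Proof. by move=> hI Ix; rewrite -[- x]add0r; apply: idealB (ideal0 hI) Ix. Qed.

Lemma idealD I x y : is_ideal I -> I x -> I y -> I (x + y).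
Proof.
by move=> hI Ix Iy; rewrite -[y]opprK; apply: idealB => //; apply: idealN.
Qed.

Lemma ideal_sum I (T : Type) (r : seq T) (Q : pred T) (F : T -> D) :
  is_ideal I -> (forall i, Q i -> I (F i)) -> I (\sum_(i <- r | Q i) F i).
Proof.
move=> hI IF; elim/big_ind: _ => //; first exact: ideal0.
by move=> x y; apply: idealD.
Qed.

Lemma idealDl I x y : is_ideal I -> I x -> I (x + y) -> I y.
Proof. by move=> hI Ix Ixy; have := idealB hI Ixy Ix; rewrite addrC addKr. Qed.

Lemma maximal_ideal_sub P I :
  maximal_ideal P -> is_ideal I -> ~ I 1 -> (forall x, P x -> I x) ->
  forall x, I x -> P x.
Proof. by case=> _ _ maxP hI I1 PI; case: (maxP I hI PI). Qed.

Lemma maximal_ideal_inv P x :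
  maximal_ideal P -> ~ P x -> exists y, P (1 - y * x).
Proof.
move=> maxP nPx; apply: contrapT => noinv.
have [hP _ _] := maxP.
pose J z := exists a p, P p /\ z = a * x + p.
have hJ : is_ideal J; first split.
- by exists 0, 0; split; [apply: ideal0 | ring].
- move=> _ _ [a [p [Pp ->]]] [b [q [Pq ->]]].
  by exists (a - b), (p - q); split; [apply: idealB | ring].
- move=> b _ [a [p [Pp ->]]].
  by exists (b * a), (b * p); split; [apply: idealMl | ring].
case: nPx; apply: (maximal_ideal_sub maxP hJ).
- move=> [a [p [Pp def1]]]; apply: noinv; exists a.
  by rewrite def1 addrC addKr.
- by move=> z Pz; exists 0, z; split=> //; ring.
- by exists 1, 0; split; [exact: ideal0 | ring].
Qed.

Lemma maximal_ideal_prime P : maximal_ideal P -> prime_ideal P.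
Proof.
move=> maxP; have [hP P1 _] := maxP; split=> // x y Pxy.
have [Px|nPx] := pselect (P x); [by left | right].
have [a Pa] := maximal_ideal_inv maxP nPx.
have -> : y = (1 - a * x) * y + a * (x * y) by ring.
by apply: idealD => //; [apply: idealMr | apply: idealMl].
Qed.

Lemma prime_idealX P x k : prime_ideal P -> P (x ^+ k) -> P x.
Proof.
case=> hP P1 prP; elim: k => [|k IHk]; first by rewrite expr0.
by rewrite exprS => /prP[].
Qed.

Lemma prime_ideal_prod P (T : Type) (r : seq T) (Q : pred T) (F : T -> D) :
  prime_ideal P -> (forall i, Q i -> ~ P (F i)) ->
  ~ P (\prod_(i <- r | Q i) F i).
Proof.
case=> hP P1 prP nPF; elim/big_ind: _ => // x y nPx nPy /prP[]; tauto.
Qed.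

(** Otherwise dependent choice gives a strictly increasing chain, whose union is finitely generated.
    The ideals are indexed by [T] so that the maximum returns the datum that defines the ideal. *)
Lemma noetherian_max (T : Type) (F : T -> Prop) (I : T -> D -> Prop) :
  noetherian D -> (forall t, F t -> is_ideal (I t)) -> (exists t, F t) ->
  exists t, F t /\
    forall t', F t' -> (forall x, I t x -> I t' x) -> forall x, I t' x -> I t x.
Proof.
move=> noethD idF [t0 Ft0]; apply: contrapT => nomax.
have /choice[next nextP] : forall u : {t | F t}, exists u' : {t | F t},
    (forall x, I (sval u) x -> I (sval u') x) /\
    ~ (forall x, I (sval u') x -> I (sval u) x).
  move=> [t Ft]; apply: contrapT => nou; apply: nomax; exists t; split=> //.
  move=> t' Ft' sub; apply: contrapT => nsub.
  by apply: nou; exists (exist _ t' Ft').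
pose ch k := I (sval (iter k next (exist _ t0 Ft0))).
have idch k : is_ideal (ch k) by apply: idF; apply: (svalP (iter _ _ _)).
have chS k x : ch k x -> ch k.+1 x by apply: (nextP _).1.
have chD k l x : (k <= l)%N -> ch k x -> ch l x.
  move=> /subnK <-; elim: (l - k)%N => // d IH /IH; exact: chS.
pose U x := exists k, ch k x.
have [] := noethD U.
  split; first by exists 0%N; apply: ideal0.
  - move=> x y [k kx] [l ly]; exists (maxn k l).
    by apply: idealB => //; [apply: chD kx | apply: chD ly]; rewrite ?leq_maxl ?leq_maxr.
  - by move=> a x [k kx]; exists k; apply: idealMl.
move=> s sP.
have /choice[kk kkP] : forall i : 'I_(size s), exists k, ch k s`_i.
  move=> i; apply/(sP s`_i); exists (fun j => (j == i)%:R).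
  rewrite (bigD1 i) //= eqxx mul1r big1 ?addr0 // => j /negPf->.
  by rewrite mul0r.
pose k := \max_i kk i.
(* All generators of the union lie in [ch k], so the next ideal adds nothing, against its choice. *)
have := (nextP (iter k next (exist _ t0 Ft0))).2; apply=> x.
change (ch k.+1 x -> ch k x) => kx.
have /(sP x)[c ->] : U x by exists k.+1.
apply: ideal_sum => // i _; apply: idealMl => //.
by apply: chD (kkP i); apply: leq_bigmax.
Qed.

End Ideals.

(** * Localization of a Dedekind domain at a maximal ideal, without fractions *)

Section LocalTheory.
Variable D : idomainType.
Implicit Types (P : D -> Prop) (a b c x y : D).

(* [e] spans a copy of [D/P] inside [D/cD]: it is obtained by making the
   annihilator of a class mod [c] maximal among those contained in [P]. *)
Lemma maximal_ideal_associated P c :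
  noetherian D -> dim_le1 D -> maximal_ideal P -> P c -> c != 0 ->
  exists e, ~ (exists z, e = c * z) /\ forall p, P p -> exists z, e * p = c * z.
Proof.
move=> noethD dimD maxP Pc c0; have [hP P1 _] := maxP.
have [_ _ prP] := maximal_ideal_prime maxP.
pose I e x := exists z, e * x = c * z.
have idI e : is_ideal (I e).
  split; first by exists 0; rewrite !mulr0.
  - by move=> x y [z ez] [w ew]; exists (z - w); rewrite !mulrBr ez ew.
  - by move=> a x [z ez]; exists (a * z); rewrite mulrCA ez mulrCA.
have Ic e : I e c by exists e; rewrite mulrC.
have IM e a x : I e x -> I (e * a) x.
  by case=> z ez; exists (z * a); rewrite mulrAC ez mulrA.
have [e _||e [IeP maxe]] := noetherian_max (F := fun e => forall x, I e x -> P x)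
  (I := I) noethD; first exact: idI.
  by exists 1 => x [z]; rewrite mul1r => ->; apply: idealMr.
have prI : prime_ideal (I e).
  split=> // [/IeP//|x y [z exy]].
  (* If [I (e * y)] stays inside [P], maximality gives [x] in [I e]. Otherwise some [w] outside [P]
     lies in it; then [I (e * w)] stays inside [P], and maximality gives [y] in [I e]. *)
  have [IyP|/existsNP[w /not_implyP[[t et] nPw]]] :=
    pselect (forall w, I (e * y) w -> P w).
    left; apply: (maxe (e * y)) => // [w|]; first exact: IM.
    by exists z; rewrite -exy; ring.
  right; apply: (maxe (e * w)) => [v [u eu]|v|]; last 2 first.
  - exact: IM.
  - by exists t; rewrite -et; ring.
  by have /prP[] : P (w * v) by apply: IeP; exists u; rewrite mulrA.
exists e; split=> [[z ez]|].
  by apply: P1; apply: IeP; exists z; rewrite mulr1.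
(* [I e] is a prime containing [c], hence maximal, and so equal to [P]. *)
apply: (@maximal_ideal_sub _ (I e)) => //; apply: dimD => //.
by exists c; split=> //; apply/eqP.
Qed.

(* The Cayley-Hamilton trick: [b / a] stabilises the finitely generated
   nonzero ideal [I], so it is an eigenvalue of a matrix over [D]. *)
Lemma fraction_integral (I : D -> Prop) a b :
  noetherian D -> integrally_closed D -> is_ideal I -> a != 0 ->
  (exists x, I x /\ x != 0) ->
  (forall x, I x -> exists y, I y /\ b * x = a * y) -> exists z, b = a * z.
Proof.
move=> noethD icD hI a0 [x0 [Ix0 x00]] stab.
have [s sP] := noethD I hI.
have Is i : (i < size s)%N -> I s`_i.
  move=> ltis; apply/sP; exists (fun j => ((j : nat) == i)%:R).
  rewrite (bigD1 (Ordinal ltis)) //= eqxx mul1r big1 ?addr0 // => j.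
  by rewrite -val_eqE /= => /negPf->; rewrite mul0r.
have /choice[C CP] : forall i : 'I_(size s), exists c : 'I_(size s) -> D,
    b * s`_i = a * \sum_j c j * s`_j.
  move=> i; have [y [Iy def_y]] := stab _ (Is i (ltn_ord i)).
  by have /sP[c yc] := Iy; exists c; rewrite def_y yc.
(* The transpose of [C], because eigenvectors are rows. *)
pose A : 'M[D]_(size s) := \matrix_(i, j) C j i.
pose v : 'rV[{fraction D}]_(size s) := \row_i FracField.tofrac s`_i.
have a0' : FracField.tofrac a != 0 by rewrite tofrac_eq0.
have : eigenvalue (map_mx (@FracField.tofrac D) A)
    (FracField.tofrac b / FracField.tofrac a).
  apply/eigenvalueP; exists v.
    apply/rowP=> i; rewrite !mxE; apply: (mulfI a0').
    rewrite mulrA mulrCA mulfV // mulr1 -tofracM CP tofracM.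
    congr (_ * _); rewrite rmorph_sum; apply: eq_bigr => j _ /=.
    by rewrite !mxE tofracM mulrC.
  apply/negP=> /eqP v0; have /sP[c def_x0] := Ix0.
  case/eqP: x00; rewrite def_x0 big1 // => i _.
  have /eqP : v 0 i = 0 by rewrite v0 mxE.
  by rewrite mxE tofrac_eq0 => /eqP->; rewrite mulr0.
rewrite eigenvalue_root_char -map_char_poly.
move=> /(icD _ _ (char_poly_monic _))[z /(canRL (divfK a0'))].
move=> /eqP; rewrite -tofracM tofrac_eq => /eqP ->.
by exists z; rewrite mulrC.
Qed.

(** [t] generates the maximal ideal of the localization at [P]; the single [u] clears the
    denominators of all quotients [p / t] at once. *)
Definition uniformizer P t u :=
  [/\ P t, ~ P u & forall p, P p -> exists q, u * p = t * q].

(** An element [b / a] outside [D] with [b P] inside [a D] is not integral, so it does not map [P]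
    into itself. Some [p0] in [P] thus goes to an element [u] outside [P], and [p0] is the
    uniformizer. *)
Lemma uniformizer_exists P :
  dedekind D -> maximal_ideal P -> (exists x, P x /\ x != 0) ->
  exists t u, uniformizer P t u.
Proof.
move=> [noethD icD dimD] maxP [a [Pa a0]]; have [hP P1 _] := maxP.
have [b [ndvd bP]] := maximal_ideal_associated noethD dimD maxP Pa a0.
have /existsNP[p0 /not_implyP[Pp0 nst]] :
    ~ (forall x, P x -> exists y, P y /\ b * x = a * y).
  by move=> stab; case: ndvd; apply: (fraction_integral noethD icD hP) => //; exists a.
have [u bp0] := bP _ Pp0.
exists p0, u; split=> // [Pu|p /bP[q bpq]]; first by apply: nst; exists u.
exists q; apply: (mulfI a0).
by rewrite mulrA -bp0 mulrAC bpq; ring.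
Qed.

End LocalTheory.

(** * Finitely many distinct maximal ideals: Chinese remainders and a common exponent *)

Section FiniteFamily.
Variables (D : comNzRingType) (I : finType) (P : I -> D -> Prop).
Hypothesis maxP : forall i, maximal_ideal (P i).
Hypothesis distinctP : forall i j, i != j -> ~ (forall x, P i x <-> P j x).

(** Each [d j] in the proof is 1 modulo [P j] and 0 modulo the other ideals; [x] is the sum of those
    with [j] outside [A]. *)
Lemma maximal_ideal_chinese (A : pred I) :
  exists x, (forall i, A i -> P i x) /\ (forall i, ~~ A i -> P i (1 - x)).
Proof.
have idP i : is_ideal (P i) by case: (maxP i).
have /choice[z zP] : forall ij : I * I, exists z,
    ij.1 != ij.2 -> P ij.1 z /\ P ij.2 (1 - z).
  move=> [i j] /=; have [_|nij] := eqVneq i j; first by exists 0.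
  have [a [Pia nPja]] : exists a, P i a /\ ~ P j a.
    apply: contrapT => noa; have ij x : P i x -> P j x.
      by move=> Pix; apply: contrapT => nPjx; apply: noa; exists x.
    apply: (distinctP nij) => x; split; first exact: ij.
    by have [_ Pj1 _] := maxP j; apply: (maximal_ideal_sub (maxP i)).
  have [y Py] := maximal_ideal_inv (maxP j) nPja.
  by exists (y * a) => _; split=> //; apply: idealMl.
pose d j := \prod_(i | i != j) z (i, j).
have dP i j : i != j -> P i (d j).
  move=> nij; rewrite /d (bigD1 i) //=; apply: idealMr => //.
  by have /(_ nij)[] := zP (i, j).
have d1P j : P j (1 - d j).
  rewrite /d; elim/big_ind: _ => [|x y Px Py|i nij].
  - by rewrite subrr; apply: ideal0.
  - have -> : 1 - x * y = (1 - x) + x * (1 - y) by ring.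
    by apply: idealD => //; apply: idealMl.
  - by have /(_ nij)[] := zP (i, j).
exists (\sum_(j | ~~ A j) d j); split=> i Ai.
  apply: ideal_sum => // j nAj; apply: dP.
  by apply: contraNneq nAj => <-.
rewrite (bigD1 i) //= opprD addrA; apply: idealB => //.
by apply: ideal_sum => // j /andP[_]; rewrite eq_sym; apply: dP.
Qed.

(* Pigeonhole on the powers of [d] modulo [P i]. *)
Lemma finite_index_exponent :
  (forall i, finite_index (P i)) ->
  exists L, (0 < L)%N /\ forall i d, ~ P i d -> P i (1 - d ^+ L).
Proof.
move=> finP; have idP i : is_ideal (P i) by case: (maxP i).
have /choice[s sP] := finP.
(* A period found modulo [P i] is at most [size (s i)], so it divides the factorial. *)
pose L := \prod_i (size (s i))`!.
exists L; split=> [|i d nPd].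
  by rewrite prodn_gt0 // => i; apply: fact_gt0.
have [y yP] : exists y : nat -> D, forall k, y k \in s i /\ P i (d ^+ k - y k).
  have /choice[y yP] : forall k, exists y, y \in s i /\ P i (d ^+ k - y).
    by move=> k; have [y ys Py] := sP i (d ^+ k); exists y.
  by exists y.
have [k [l [ltkl lel eqy]]] : exists k l, [/\ (k < l)%N, (l <= size (s i))%N & y k = y l].
  pose t := [seq y k | k <- iota 0 (size (s i)).+1].
  have : ~~ uniq t.
    apply/negP => ut; have: (size t <= size (s i))%N.
      by apply: uniq_leq_size ut _ => _ /mapP[k _ ->]; case: (yP k).
    by rewrite size_map size_iota ltnn.
  move=> /(uniqPn 0)[k [l []]]; rewrite size_map size_iota => kl lt.
  rewrite !(nth_map 0%N) ?size_iota ?nth_iota ?(ltn_trans kl) //.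
  by exists k, l.
have : P i (d ^+ k * (1 - d ^+ (l - k))).
  rewrite mulrBr mulr1 -exprD subnKC ?(ltnW ltkl) //.
  have -> : d ^+ k - d ^+ l = (d ^+ k - y k) - (d ^+ l - y l) by rewrite eqy; ring.
  by apply: idealB => //; [case: (yP k) | case: (yP l)].
have prPi := maximal_ideal_prime (maxP i); have [_ _ prP] := prPi.
move=> /prP[/(prime_idealX prPi)//|Plk].
have /dvdnP[q ->] : (l - k %| L)%N.
  rewrite /L (bigD1 i) //= dvdn_mulr // dvdn_fact //.
  by rewrite subn_gt0 ltkl (leq_trans (leq_subr _ _)).
by rewrite mulnC exprM -{1}[1](expr1n D q) subrXX; apply: idealMr.
Qed.

End FiniteFamily.

(** * Eisenstein's criterion at a maximal ideal with a uniformizer *)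

Section Eisenstein.
Variable D : idomainType.
Implicit Types (P : D -> Prop) (s G H : {poly D}).
Local Notation tofrac := (@FracField.tofrac D).

Lemma fraction_numden (x : {fraction D}) :
  exists a d, d != 0 /\ tofrac d * x = tofrac a.
Proof.
elim/quotW: x => x; exists \n_x, \d_x; split; first exact: denom_ratioP.
unlock FracField.tofrac; rewrite -[LHS]FracField.pi_mul.
apply/eqmodP; rewrite /= FracField.equivfE /FracField.mulf.
by rewrite !numden_Ratio ?oner_eq0 ?mul1r ?denom_ratioP // mulr1.
Qed.

Lemma fraction_poly_denom (q : {poly {fraction D}}) :
  exists d G, d != 0 /\ tofrac d *: q = map_poly tofrac G.
Proof.
elim/poly_ind: q => [|q c [d [G [d0 dq]]]].
  by exists 1, 0; rewrite oner_eq0 scaler0 rmorph0.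
have [a [e [e0 ec]]] := fraction_numden c.
exists (d * e), (e *: G * 'X + (d * a)%:P); rewrite mulf_neq0 //; split=> //.
rewrite tofracM [in RHS]rmorphD /= [in RHS]rmorphM /= map_polyX map_polyC.
rewrite map_polyZ -dq scalerDr; congr (_ + _).
  by rewrite [tofrac d * _]mulrC -scalerA -!scalerAl.
by rewrite -mul_polyC -polyCM -mulrA ec -tofracM.
Qed.

(** Gauss's argument: if [i] and [j] are the first places where a coefficient leaves [P], exactly
    one summand of coefficient [i + j] of the product lies outside [P]. *)
Lemma prime_ideal_coefM P G H :
  prime_ideal P -> (exists i, ~ P G`_i) -> (exists j, ~ P H`_j) ->
  exists i j, [/\ ~ P G`_i, ~ P H`_j, forall k, (k < i)%N -> P G`_k,
                  forall k, (k < j)%N -> P H`_k & ~ P (G * H)`_(i + j)].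
Proof.
move=> [hP P1 prP] exG exH.
have minP (A : {poly D}) : (exists i, ~ P A`_i) ->
    exists i, ~ P A`_i /\ forall k, (k < i)%N -> P A`_k.
  move=> exA; have exA' : exists i, `[< ~ P A`_i >].
    by have [i Ai] := exA; exists i; apply/asboolP.
  case: (ex_minnP exA') => i /asboolP Ai mini; exists i; split=> // k ltki.
  apply: contrapT => /asboolP/mini; by rewrite leqNgt ltki.
have [[i [Gi Glt]] [j [Hj Hlt]]] := (minP G exG, minP H exH).
exists i, j; split=> //; rewrite coefM.
have lti : (i < (i + j).+1)%N by rewrite ltnS leq_addr.
rewrite (bigD1 (Ordinal lti)) //= addKn addrC => PGH.
have : P (G`_i * H`_j).
  apply: (idealDl hP _ PGH); apply: ideal_sum => // k.
  rewrite -val_eqE neq_ltn /= => /orP[ltki|ltik].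
    by apply: idealMr => //; apply: Glt.
  apply: idealMl => //; apply: Hlt.
  by have := ltn_ord k; move: ltik => /=; lia.
by case/prP.
Qed.

(* A denominator [a] lying in [P] can be traded for [u * a / t]; that this
   stops is the ascending chain condition applied to the ideals
   [a D[1/u]] restricted to [D]. *)
Lemma denominator_notin P t u s G H a :
  noetherian D -> maximal_ideal P -> uniformizer P t u ->
  a != 0 -> a *: s = G * H ->
  exists a' G' H', [/\ ~ P a', a' *: s = G' * H', size G' = size G
                     & size H' = size H].
Proof.
move=> noethD maxP [Pt nPu tu] a0 aGH; have [hP P1 _] := maxP.
have prP := maximal_ideal_prime maxP.
have u0 : u != 0 by apply/eqP => u0; apply: nPu; rewrite u0; apply: ideal0.
pose F (x : D * {poly D} * {poly D}) :=
  [/\ x.1.1 != 0, x.1.1 *: s = x.1.2 * x.2, size x.1.2 = size G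
    & size x.2 = size H].
pose I (x : D * {poly D} * {poly D}) y := exists k z, u ^+ k * y = x.1.1 * z.
have [x _||[[b A] B] [[/= b0 bAB sA sB] maxb]] :=
  noetherian_max (F := F) (I := I) noethD; last first.
- have [Pb|nPb] := pselect (P b); last by exists b, A, B.
  have [b' ub] := tu _ Pb.
  have b'0 : b' != 0.
    by apply: contraNneq (mulf_neq0 u0 b0) => b'0; rewrite ub b'0 mulr0.
  have t0 : t != 0.
    by apply: contraNneq (mulf_neq0 u0 b0) => t0; rewrite ub t0 mul0r.
  have divt (C : {poly D}) : (forall i, P C`_i) ->
      exists2 C', u *: C = t *: C' & size C' = size C.
    move=> PC; have /choice[c cP] : forall i, exists c, u * C`_i = t * c.
      by move=> i; apply: tu.
    have uC : u *: C = t *: \poly_(i < size C) c i.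
      apply/polyP=> i; rewrite !coefZ coef_poly; case: ifP => // ltiC.
      by rewrite nth_default ?mulr0 // leqNgt ltiC.
    exists (\poly_(i < size C) c i) => //.
    by have := congr1 (fun p : {poly D} => size p) uC; rewrite !size_scale.
  (* As [b] lies in [P], Gauss's argument puts all coefficients of one factor into [P], and this
     factor can be multiplied by [u / t]. *)
  have [A' [B' [AB' sA' sB']]] : exists A' B',
      [/\ u *: (A * B) = t *: (A' * B'), size A' = size A & size B' = size B].
    have [PA|/existsNP nA] := pselect (forall i, P A`_i).
      have [A' uA sA'] := divt _ PA; exists A', B.
      by rewrite !scalerAl uA.
    have [PB|/existsNP nB] := pselect (forall i, P B`_i).
      have [B' uB sB'] := divt _ PB; exists A, B'.
      by rewrite !scalerAr uB.
    have [i [j [_ _ _ _ []]]] := prime_ideal_coefM prP nA nB.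
    by rewrite -bAB coefZ; apply: idealMr.
  have Fb' : F (b', A', B').
    split; rewrite /= ?sA' ?sB' //; apply: (@mulfI _ t%:P); rewrite ?polyC_eq0 // !mul_polyC.
    by rewrite scalerA -ub -scalerA bAB AB'.
  (* Maximality would give [u ^+ k * b' = b * z]. With [u * b = t * b'] this yields
     [u ^+ k.+1 = t * z], an element of [P], although [u] is not in [P]. *)
  have [||k [z /= uz]] := maxb (b', A', B') Fb' _ b'.
  - move=> y [k [z uz]]; exists k.+1, (t * z) => /=.
    by rewrite exprS -mulrA uz /= mulrA ub; ring.
  - by exists 0%N, 1; rewrite expr0 mul1r mulr1.
  - case: nPu; apply: (prime_idealX (k := k.+1) prP).
    suff -> : u ^+ k.+1 = t * z by apply: idealMr.
    by apply: (mulfI b0); rewrite exprSr [RHS]mulrCA -uz [RHS]mulrCA -ub; ring.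
- by exists (a, G, H).
- split; first by exists 0%N, 0; rewrite !mulr0.
  + move=> y y' [k [z uz]] [k' [z' uz']].
    exists (k + k')%N, (u ^+ k' * z - u ^+ k * z').
    have -> : u ^+ (k + k') * (y - y') =
      u ^+ k' * (u ^+ k * y) - u ^+ k * (u ^+ k' * y') by rewrite exprD; ring.
    by rewrite uz uz'; ring.
  + by move=> d y [k [z uz]]; exists k, (d * z); rewrite mulrCA uz mulrCA.
Qed.

(** The hypothesis on the constant coefficient is a local way of placing it outside the square of
    [P]: the multiplier [w] accounts for the denominator outside [P] that remains after clearing. *)
Lemma eisenstein P t u s M :
  noetherian D -> maximal_ideal P -> uniformizer P t u -> (0 < M)%N ->
  size s = M.+1 -> ~ P s`_M -> (forall i, (i < M)%N -> P s`_i) ->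
  (forall a b w, P a -> P b -> w * s`_0 = a * b -> P w) ->
  irreducible_poly (map_poly tofrac s).
Proof.
move=> noethD maxP unifP M0 ss sM slt s0P; have [hP P1 prP] := maximal_ideal_prime maxP.
have injF : injective tofrac by move=> x y /eqP; rewrite tofrac_eq => /eqP.
have sz (A : {poly D}) : size (map_poly tofrac A) = size A.
  exact: size_map_inj_poly.
have s0 : s != 0 by rewrite -size_poly_eq0 ss.
split=> [|q q1 /dvdpP[h def_s]]; first by rewrite sz ss.
have [d [G [d0 dq]]] := fraction_poly_denom q.
have [e [H [e0 eh]]] := fraction_poly_denom h.
have deGH : (d * e) *: s = G * H.
  apply: (map_inj_poly injF); first by rewrite tofrac0.
  rewrite map_polyZ [RHS]rmorphM /= -dq -eh def_s tofracM.
  by rewrite -scalerAl -scalerAr scalerA [h * q]mulrC.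
have [a [A [B [nPa aAB sA sB]]]] :=
  denominator_notin noethD maxP unifP (mulf_neq0 d0 e0) deGH.
have a0 : a != 0 by apply/eqP => a0; apply: nPa; rewrite a0; apply: ideal0.
have coefAB i : (A * B)`_i = a * s`_i by rewrite -aAB coefZ.
have nPM : ~ P (A * B)`_M by rewrite coefAB => /prP[].
have exA : exists i, ~ P A`_i.
  apply: contrapT => noA; apply: nPM; rewrite coefM; apply: ideal_sum => // i _.
  by apply: idealMr => //; apply: contrapT => nA; apply: noA; exists i.
have exB : exists i, ~ P B`_i.
  apply: contrapT => noB; apply: nPM; rewrite coefM; apply: ideal_sum => // i _.
  by apply: idealMl => //; apply: contrapT => nB; apply: noB; exists (M - i)%N.
have [|i [j [Ai Bj Alt Blt nPij]]] := prime_ideal_coefM _ exA exB.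
  exact: maximal_ideal_prime.
(* All coefficients of [A * B] below [M] lie in [P]. With the degree count below, [i] and [j] must
   be the full degrees of [A] and [B]. *)
have ltM : (M <= i + j)%N.
  rewrite leqNgt; apply/negP => ltij; apply: nPij; rewrite coefAB.
  by apply: idealMl => //; apply: slt.
have nz k (C : {poly D}) : ~ P C`_k -> (k < size C)%N.
  move=> nP; rewrite ltnNge; apply/negP => le; apply: nP.
  by rewrite nth_default //; apply: ideal0.
have [ltiA ltjB] := (nz _ _ Ai, nz _ _ Bj).
have szAB : ((size A + size B).-1 = M.+1)%N.
  rewrite -size_mul -?size_poly_gt0 ?(leq_ltn_trans _ ltiA) //; last first.
    exact: leq_ltn_trans ltjB.
  by rewrite -aAB size_scale.
have q0 : q != 0.
  apply: contraNneq s0 => q0; rewrite -size_poly_eq0 -sz def_s q0 mulr0.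
  by rewrite size_poly0.
have sq : size q = size A.
  by rewrite sA -sz -dq size_scale // tofrac_eq0.
(* If [i] and [j] are both positive, both constant coefficients lie in [P], which [s0P] excludes;
   [i = 0] would make [q] constant. So [B], and with it [h], is constant. *)
case: j => [|j] in ltM Bj ltjB Blt nPij *; last first.
  case: i => [|i] in ltM Ai ltiA Alt nPij *.
    have : size A = 1%N by lia.
    by rewrite -sq => sq1; rewrite sq1 in q1.
  case: nPa; apply: (s0P A`_0 B`_0); [exact: Alt | exact: Blt|].
  by rewrite -coefAB coef0M.
have sB1 : size B = 1%N by lia.
have : size h == 1%N by rewrite -(size_scale h (a := tofrac e)) ?tofrac_eq0 // eh sz -sB sB1.
case/size_poly1P=> k k0 hk; rewrite def_s hk mul_polyC eqp_sym.
exact: eqp_scale.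
Qed.

End Eisenstein.

(** * Units of the ring of integer-valued polynomials *)

Section IntUnits.
Variable D : idomainType.
Local Notation tofrac := (@FracField.tofrac D).
Implicit Types (f g u : {poly {fraction D}}) (x y : {fraction D}).

Lemma tofrac_inj : injective tofrac.
Proof. by move=> x y /eqP; rewrite tofrac_eq => /eqP. Qed.

Lemma intD_mul f g : intD f -> intD g -> intD (f * g).
Proof.
move=> hf hg d; have [[x fx] [y gy]] := (hf d, hg d).
by exists (x * y); rewrite hornerM fx gy tofracM.
Qed.

Lemma intD_const (d : D) : intD (tofrac d)%:P.
Proof. by move=> z; exists d; rewrite hornerC. Qed.

Lemma intD1 : intD (1 : {poly {fraction D}}).
Proof. by move=> z; exists 1; rewrite hornerC tofrac1. Qed.

Lemma intD_prod (F : seq {poly {fraction D}}) :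
  (forall a, a \in F -> intD a) -> intD (\prod_(a <- F) a).
Proof.
move=> hF; rewrite big_seq; elim/big_ind: _ => //; first exact: intD1.
by move=> a b; apply: intD_mul.
Qed.

Definition unit_frac x := exists d e : D, x = tofrac d /\ d * e = 1.

Lemma unit_frac1 : unit_frac 1.
Proof. by exists 1, 1; rewrite mulr1 tofrac1. Qed.

Lemma unit_frac_neq0 x : unit_frac x -> x != 0.
Proof.
move=> [d [e [-> de]]]; rewrite tofrac_eq0; apply: contra_eqN (esym de) => /eqP->.
by rewrite mul0r oner_eq0.
Qed.

Lemma unit_fracV x : unit_frac x -> unit_frac x^-1.
Proof.
move=> ux; have x0 := unit_frac_neq0 ux; have [d [e [dx de]]] := ux.
exists e, d; split; last by rewrite mulrC.
by apply: (mulfI x0); rewrite divff // dx -tofracM de tofrac1.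
Qed.

Lemma unit_frac_mul_inv (d e : D) :
  unit_frac (tofrac d * tofrac e) -> unit_frac (tofrac d).
Proof.
move=> [z [w [+ zw]]]; rewrite -tofracM => /tofrac_inj dez.
by exists d, (e * w); rewrite mulrA dez.
Qed.

(** The degree forces a unit and its inverse to be constants, and their values at 0 lie in [D]. *)
Lemma unitIntP u : unitInt u <-> exists x, unit_frac x /\ u = x%:P.
Proof.
split=> [[uD [v [vD uv]]]|[x [ux ->]]].
  have: size (u * v) == 1%N by rewrite uv size_poly1.
  rewrite size_mul_eq1 => /andP[/size_poly1P[x x0 ux] /size_poly1P[y y0 vy]].
  exists x; split=> //; have [[d ud] [e ve]] := (uD 0, vD 0).
  move: ud ve uv; rewrite ux vy !hornerC => -> ->.
  rewrite -polyCM => /polyC_inj xy.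
  by apply: (@unit_frac_mul_inv d e); rewrite xy; apply: unit_frac1.
have [d [_ [xd _]]] := ux; have [e [_ [xe _]]] := unit_fracV ux.
split; first by rewrite xd; apply: intD_const.
exists (x^-1)%:P; split; first by rewrite xe; apply: intD_const.
by rewrite -polyCM divff // unit_frac_neq0.
Qed.

Lemma intD_unit_scale x f : unit_frac x -> intD (x *: f) <-> intD f.
Proof.
have scale y g : unit_frac y -> intD g -> intD (y *: g).
  move=> [d [_ [-> _]]] hg; rewrite -mul_polyC; apply: intD_mul => //.
  exact: intD_const.
move=> ux; split=> [/(scale _ _ (unit_fracV ux))|]; last exact: scale.
by rewrite scalerA mulVf ?scale1r // unit_frac_neq0.
Qed.

End IntUnits.

(** * Products of irreducible polynomials over a field *)

Section ProductsOfIrreducibles.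
Variables (K : fieldType) (I : finType) (p : I -> {poly K}).
Hypothesis irr_p : forall i, irreducible_poly (p i).
Implicit Types (A B : {set I}).

Lemma irreducible_dvdp_mul (q a b : {poly K}) :
  irreducible_poly q -> q %| a * b -> q %| a \/ q %| b.
Proof.
move=> irr_q qab; have [qa|nqa] := boolP (q %| a); [by left | right].
by rewrite -(Gauss_dvdpr b (d := q) (q := a)) // irreducible_poly_coprime.
Qed.

(** Unique factorization up to scalars: each [p i] divides one of the two factors and is peeled off
    by induction on the size of [A]. *)
Lemma mul_prod_irreducible A (x : K) (a b : {poly K}) :
  x != 0 -> a * b = x *: \prod_(i in A) p i ->
  exists B y z, [/\ B \subset A, a = y *: \prod_(i in B) p i
                  & b = z *: \prod_(i in A :\: B) p i].
Proof.
move=> x0; have [n] := ubnP #|A|; elim: n => // n IHn in A a b *.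
have [-> _|[i Ai]] := set_0Vmem A.
  rewrite big_set0 => ab; have: size (a * b) == 1%N.
    by rewrite ab size_scale // size_poly1.
  rewrite size_mul_eq1 => /andP[/size_poly1P[y _ ->] /size_poly1P[z _ ->]].
  by exists set0, y, z; rewrite setD0 !big_set0 sub0set !alg_polyC.
rewrite (cardsD1 i) Ai ltnS => leAn; rewrite (big_setD1 i) //= => ab.
have p0 : p i != 0 by apply: irredp_neq0.
have [||/dvdpP[a' def_a]|/dvdpP[b' def_b]] := @irreducible_dvdp_mul (p i) a b.
- exact: irr_p.
- by rewrite ab dvdpZr // dvdp_mulr.
- have [||B [y [z [sBA a'y bz]]]] := IHn (A :\ i) a' b => //.
    by apply: (mulfI p0); rewrite -scalerAr -ab def_a; ring.
  have nBi : i \notin B.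
    by apply: contraTN isT => /(subsetP sBA); rewrite !inE eqxx.
  exists (i |: B), y, z; split.
  + by rewrite subUset sub1set Ai (subset_trans sBA) ?subD1set.
  + by rewrite big_setU1 //= def_a a'y -scalerAl mulrC.
  + by rewrite bz setDDl.
- have [||B [y [z [sBA ay b'z]]]] := IHn (A :\ i) a b' => //.
    by apply: (mulfI p0); rewrite -scalerAr -ab def_b; ring.
  have nBi : i \notin B.
    by apply: contraTN isT => /(subsetP sBA); rewrite !inE eqxx.
  exists B, y, z; split=> //; first by rewrite (subset_trans sBA) ?subD1set.
  rewrite (big_setD1 i) /=; last by rewrite !inE nBi.
  rewrite def_b b'z -scalerAl mulrC; congr (_ *: (_ * _)).
  by apply: eq_bigl => j; rewrite !inE andbCA.
Qed.

(** After exchanging the products, [p i] occurs once for each member of [L] containing [i]. *)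
Lemma prod_set_count (L : seq {set I}) A :
  (forall i, count (fun X : {set I} => i \in X) L = (i \in A)) ->
  \prod_(X <- L) \prod_(i in X) p i = \prod_(i in A) p i.
Proof.
move=> cntL; rewrite [RHS]big_mkcond.
under eq_bigr do rewrite big_mkcond.
rewrite exchange_big; apply: eq_bigr => i _ /=.
rewrite -[RHS]/(if i \in A then p i else 1).
have -> : (if i \in A then p i else 1) = p i ^+ (i \in A).
  by case: (i \in A).
rewrite -cntL -sumn_count sumnE big_map -prodrXr.
by apply: eq_bigr => X _; case: (i \in X).
Qed.

End ProductsOfIrreducibles.

(** * Factorizations as partitions into indecomposable sets *)

Section Factorizations.
Variables (D : idomainType) (V : finType) (n : nat) (tag : V -> 'I_n).
Variable p : option V -> {poly {fraction D}}.
Hypothesis n_gt0 : (0 < n)%N.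
Hypothesis tag_surj : forall k, exists v, tag v = k.
Hypothesis irr_p : forall i, irreducible_poly (p i).
Hypothesis p_at1 : forall i, (p i).[1] = 1.
Hypothesis size_p_None : (2 < size (p None))%N.
Hypothesis size_p_Some : forall v, size (p (Some v)) = 2%N.
Hypothesis p_Some_inj : injective (fun v => p (Some v)).
Implicit Types (A B X Y : {set option V}) (L : seq {set option V}).
Implicit Types (a b g : {poly {fraction D}}) (G : seq {poly {fraction D}}).

Definition prodp A := \prod_(i in A) p i.

(** [None] indexes the factor with a denominator, [Some v] the linear factor of the vertex [v]. The
    condition is that the vertices in [A] form a vertex cover of the complete multipartite graph;
    without [None] there is no denominator to cancel. *)
Definition covers A := None \in A ->
  forall v w, Some v \notin A -> Some w \notin A -> tag v = tag w.

Hypothesis intD_prodp : forall A, intD (prodp A) <-> covers A.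

Lemma prodp_at1 A : (prodp A).[1] = 1.
Proof. by rewrite horner_prod big1. Qed.

Lemma prodp_neq0 A : prodp A != 0.
Proof.
by apply: contra_eq_neq (prodp_at1 A) => ->; rewrite horner0 eq_sym oner_eq0.
Qed.

Lemma prodp0 : prodp set0 = 1.
Proof. by rewrite /prodp big_set0. Qed.

Lemma leq_size_prodp i A : i \in A -> (size (p i) <= size (prodp A))%N.
Proof.
move=> Ai; apply: dvdp_leq; first exact: prodp_neq0.
by rewrite /prodp (big_setD1 i) //= dvdp_mulr.
Qed.

Lemma prodp_unit A (x : {fraction D}) : unitInt (x *: prodp A) -> A = set0.
Proof.
case/unitIntP=> y [uy def_y]; apply/eqP; apply/set0Pn => -[i /leq_size_prodp].
have [ltp _] := irr_p i; rewrite leqNgt; apply/negP; rewrite negbK.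
have x0 : x != 0.
  apply: contraTneq (unit_frac_neq0 uy) => x0.
  by move: def_y; rewrite x0 scale0r => /esym/eqP; rewrite polyC_eq0 negbK.
rewrite -(size_scale _ x0) def_y; apply: leq_ltn_trans ltp.
exact: size_polyC_leq1.
Qed.

(** Unique factorization yields scalars in the fraction field. Evaluation at 1, where each [prodp]
    is 1, puts them in [D] and shows that their product is the unit [x]. *)
Lemma mul_prodp A (x : {fraction D}) a b :
  unit_frac x -> intD a -> intD b -> a * b = x *: prodp A ->
  exists B y z, [/\ B \subset A, unit_frac y, unit_frac z,
    a = y *: prodp B & b = z *: prodp (A :\: B)].
Proof.
move=> ux aD bD ab.
have [B [y [z [sBA ay bz]]]] := mul_prod_irreducible irr_p (unit_frac_neq0 ux) ab.
have [[d ad] [e be]] := (aD 1, bD 1).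
have yd : y = tofrac d by rewrite -ad tofrac1 ay hornerZ prodp_at1 mulr1.
have ze : z = tofrac e by rewrite -be tofrac1 bz hornerZ prodp_at1 mulr1.
have xyz : y * z = x.
  have := congr1 (fun q : {poly {fraction D}} => q.[1]) ab.
  by rewrite ay bz hornerM !hornerZ !prodp_at1 !mulr1.
exists B, y, z; split=> //.
  by rewrite yd; apply: (@unit_frac_mul_inv _ d e); rewrite -yd -ze xyz.
by rewrite ze; apply: (@unit_frac_mul_inv _ e d); rewrite -yd -ze mulrC xyz.
Qed.

Definition indecomposable A := [/\ A != set0, covers A &
  forall B, B \subset A -> covers B -> covers (A :\: B) -> B = set0 \/ B = A].

(** By [mul_prodp], splittings of the polynomial are, up to units, splittings of [A] into two sets
    satisfying [covers]. *)
Lemma irredInt_prodp A (x : {fraction D}) :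
  unit_frac x -> irredInt (x *: prodp A) <-> indecomposable A.
Proof.
move=> ux; split=> [[xD _ nux irrx]|[A0 covA indA]].
  split.
  - apply/eqP => A0; apply: nux; rewrite A0 prodp0 alg_polyC.
    by apply/unitIntP; exists x.
  - by apply/intD_prodp; apply/(intD_unit_scale _ ux).
  - move=> B sBA /intD_prodp BD /intD_prodp ABD.
    case: (irrx (x *: prodp B) (prodp (A :\: B))) => //.
    + exact/intD_unit_scale.
    + rewrite -scalerAl; congr (_ *: _).
      by rewrite /prodp [LHS](big_setID B) /= (setIidPr sBA).
    + by move/prodp_unit; left.
    + rewrite -[prodp _]scale1r => /prodp_unit /eqP.
      by rewrite setD_eq0 => sAB; right; apply/eqP; rewrite eqEsubset sBA.
split.
- exact/(intD_unit_scale _ ux)/intD_prodp.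
- by apply/eqP; rewrite scaler_eq0 negb_or unit_frac_neq0 ?prodp_neq0.
- by move/prodp_unit/eqP; apply/negP.
- move=> a b aD bD /esym /(mul_prodp ux aD bD)[B [y [z [sBA uy uz ay bz]]]].
  case: (indA B) => // [||B0|BA].
  + by apply/intD_prodp/(intD_unit_scale _ uy); rewrite -ay.
  + by apply/intD_prodp/(intD_unit_scale _ uz); rewrite -bz.
  + left; apply/unitIntP; exists y; split=> //.
    by rewrite ay B0 prodp0 alg_polyC.
  + right; apply/unitIntP; exists z; split=> //.
    by rewrite bz BA setDv prodp0 alg_polyC.
Qed.

Definition block k := [set v | tag v == k].
Definition base k : {set option V} := ~: (Some @: block k).
Definition pieces k := base k :: [seq [set Some v] | v <- enum (block k)].

Lemma mem_base k v : (Some v \in base k) = (tag v != k).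
Proof. by rewrite inE mem_imset ?inE //; apply: Some_inj. Qed.

Lemma None_base k : None \in base k.
Proof. by rewrite inE; apply/imsetP => -[]. Qed.

Lemma indecomposable_set1 v : indecomposable [set Some v].
Proof.
split=> [||B]; first by apply/set0Pn; exists (Some v); rewrite set11.
  by rewrite /covers inE.
by rewrite subset1 => /orP[/eqP|/eqP] ->; [right | left].
Qed.

Lemma covers_base k : covers (base k).
Proof. by move=> _ v w; rewrite !mem_base !negbK => /eqP-> /eqP->. Qed.

(** Blocks are nonempty: a vertex outside block [k] missing from [B] and a vertex of block [k] would
    be two missing vertices from different blocks. *)
Lemma base_sub_covers k B :
  B \subset base k -> covers B -> None \in B -> B = base k.
Proof.
move=> sB covB BN; apply/eqP; rewrite eqEsubset sB; apply/subsetP => -[w|//].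
rewrite mem_base => nwk; apply: contraNT nwk => nBw.
have [v vk] := tag_surj k; rewrite -vk; apply/eqP; apply: (covB BN) => //.
by apply: contraTN isT => /(subsetP sB); rewrite mem_base vk eqxx.
Qed.

(** One of the two parts contains [None], and by minimality of the cover that part is everything. *)
Lemma indecomposable_base k : indecomposable (base k).
Proof.
split=> [||B sB covB covBc]; first by apply/set0Pn; exists None; apply: None_base.
  exact: covers_base.
have [BN|nBN] := boolP (None \in B); first by right; apply: base_sub_covers.
left; apply/eqP; rewrite -subset0; apply/subsetP=> i Bi.
have /setP/(_ i) : base k :\: B = base k.
  by apply: base_sub_covers; rewrite ?subsetDl // inE nBN None_base.
by rewrite inE Bi (subsetP sB).
Qed.

(** With [None] in [A], the missing vertices share a block [k], and a vertex of that block still in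
    [A] could be split off. Without [None], every singleton can be split off. *)
Lemma indecomposableP A : indecomposable A ->
  (exists k, A = base k) \/ exists v, A = [set Some v].
Proof.
case=> A0 covA indA; have [AN|nAN] := boolP (None \in A); [left | right].
  have [k kP] : exists k, forall v, Some v \notin A -> tag v = k.
    have [all_A|/existsNP[v /negP nAv]] := pselect (forall v, Some v \in A).
      (* With no vertex missing, any block may serve as [k]. *)
      by exists (Ordinal n_gt0) => v; rewrite all_A.
    by exists (tag v) => w nAw; apply: (covA AN).
  exists k; apply/setP=> -[v|]; last by rewrite AN None_base.
  rewrite mem_base; apply/idP/idP=> [Av|]; last by apply: contraNT => /kP->.
  (* Taking [v] out of [A] keeps all missing vertices in block [k], so the rest still covers. *)
  apply/eqP => vk; have tagk w : Some w \notin A :\ Some v -> tag w = k.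
    by rewrite !inE negb_and negbK => /orP[/eqP[->]|/kP].
  case: (indA [set Some v]) => [||_ w w' /tagk-> /tagk->||def_A] //.
  - by rewrite sub1set.
  - by rewrite /covers inE.
  - by move/setP/(_ (Some v)); rewrite !inE eqxx.
  - by rewrite -def_A inE in AN.
have [i Ai] := set0Pn _ A0.
case: i Ai => [v Av|]; last by move=> AN; rewrite AN in nAN.
exists v; case: (indA [set Some v]) => //.
- by rewrite sub1set.
- by rewrite /covers inE.
- by rewrite /covers inE (negPf nAN) andbF.
- by move/setP/(_ (Some v)); rewrite !inE eqxx.
Qed.

Lemma count_pieces k i : count (fun X => i \in X) (pieces k) = 1%N.
Proof.
rewrite /= count_map.
case: i => [v|]; last first.
  rewrite None_base (eq_count (a2 := pred0)) ?count_pred0 // => v /=.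
  by rewrite inE.
rewrite mem_base (eq_count (a2 := pred1 v)) => [|w /=]; last first.
  by rewrite inE eq_sym.
rewrite count_uniq_mem ?enum_uniq // mem_enum inE.
by case: eqP.
Qed.

Lemma pieces_indecomposable k X : X \in pieces k -> indecomposable X.
Proof.
rewrite inE => /orP[/eqP->|/mapP[v _ ->]]; first exact: indecomposable_base.
exact: indecomposable_set1.
Qed.

Lemma count_gt1 (T : eqType) (s : seq T) (q : pred T) (x y : T) :
  x != y -> x \in s -> y \in s -> q x -> q y -> (1 < count q s)%N.
Proof.
move=> nxy sx sy qx qy; rewrite -size_filter.
apply: (@uniq_leq_size _ [:: x; y]); first by rewrite /= inE nxy.
by move=> z; rewrite !inE mem_filter => /orP[]/eqP->; apply/andP.
Qed.

(** The member containing [None] is some [base k]. By disjointness the others avoid [None], so they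
    are singletons, and their vertices fill the block [k]. *)
Lemma perm_pieces L :
  (forall X, X \in L -> indecomposable X) ->
  (forall i, count (fun X => i \in X) L = 1%N) -> exists k, perm_eq L (pieces k).
Proof.
move=> indL cntL.
have memL i : exists2 X, X \in L & i \in X.
  by apply/hasP; rewrite has_count cntL.
have uniqL X Y i : X \in L -> Y \in L -> i \in X -> i \in Y -> X = Y.
  move=> LX LY Xi Yi; apply/eqP; apply: contraT => nXY.
  by have := count_gt1 (q := fun Z : {set option V} => i \in Z) nXY LX LY Xi Yi; rewrite cntL.
(* Indecomposable sets are nonempty, so a repeated member would count one of its elements twice. *)
have uL s : (forall X, X \in s -> indecomposable X) ->
    (forall i, count (fun X => i \in X) s = 1%N) -> uniq s.
  move=> inds cnts; apply: count_mem_uniq => X.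
  have [sX|/count_memPn//] := boolP (X \in s).
  have [/set0Pn[i Xi] _ _] := inds X sX.
  apply/eqP; rewrite eqn_leq -has_count has_pred1 sX andbT [leqRHS]/= -(cnts i).
  by apply: sub_count => Y /eqP->.
have [X0 LX0 X0N] := memL None.
have [[k def_X0]|[v def_X0]] := indecomposableP (indL _ LX0); last first.
  by rewrite def_X0 inE in X0N.
exists k; apply: uniq_perm; first exact: uL.
  by apply: uL; [apply: pieces_indecomposable | apply: count_pieces].
move=> X; rewrite inE; apply/idP/orP=> [LX|[/eqP->|/mapP[v]]].
- have [[k' def_X]|[v def_X]] := indecomposableP (indL _ LX).
    left; rewrite -def_X0; apply/eqP.
    by apply: (uniqL _ _ None) => //; rewrite def_X None_base.
  right; apply/mapP; exists v => //; rewrite mem_enum inE; apply: contraT => nvk.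
  have : X = X0 by apply: (uniqL _ _ (Some v)); rewrite // ?def_X ?set11 ?def_X0 ?mem_base.
  by move=> XX0; rewrite -XX0 def_X inE in X0N.
- by rewrite -def_X0.
- rewrite mem_enum inE => /eqP vk ->; have [Y LY Yv] := memL (Some v).
  have [[k' def_Y]|[w def_Y]] := indecomposableP (indL _ LY).
    have : Y = X0 by apply: (uniqL _ _ None); rewrite // def_Y None_base.
    by move=> YX0; rewrite YX0 def_X0 mem_base vk eqxx in Yv.
  by move: Yv; rewrite def_Y inE => /eqP->; rewrite -def_Y.
Qed.

(** Splitting off one factor with [mul_prodp] leaves a product of the same shape, over the
    complement of the set already used. *)
Lemma factors_prodp G A (x : {fraction D}) :
  unit_frac x -> (forall g, g \in G -> intD g) ->
  \prod_(g <- G) g = x *: prodp A ->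
  exists L, [/\ size L = size G,
    forall j, (j < size G)%N -> exists y, unit_frac y /\ G`_j = y *: prodp (nth set0 L j)
    & forall i, count (fun X => i \in X) L = (i \in A)].
Proof.
elim: G A x => [|g G IHG] A x ux GD.
  rewrite big_nil => def_A; exists [::]; split=> // i.
  suff -> : A = set0 by rewrite inE.
  apply: (@prodp_unit _ x); rewrite -def_A.
  by apply/unitIntP; exists 1; split=> //; apply: unit_frac1.
rewrite big_cons => def_A.
have gD : intD g by apply: GD; rewrite mem_head.
have G'D a : a \in G -> intD a by move=> Ga; apply: GD; rewrite inE Ga orbT.
have [B [y [z [sBA uy uz gy Gz]]]] := mul_prodp ux gD (intD_prod G'D) def_A.
have [L [sL GL cntL]] := IHG _ _ uz G'D Gz.
exists (B :: L); split=> [|[|j] //= ltj|i /=]; first by rewrite /= sL.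
- by exists y.
- exact: GL.
- rewrite cntL inE; have [/(subsetP sBA)->|] // := boolP (i \in B).
Qed.

Lemma exists_factorizations :
  exists F : 'I_n -> seq {poly {fraction D}},
    [/\ forall k, factorizationInt (prodp setT) (F k),
        forall k, size (F k) = #|block k|.+1,
        forall k l, k != l -> ~ ess_same (F k) (F l) &
        forall G, factorizationInt (prodp setT) G -> exists k, ess_same G (F k)].
Proof.
have u1 := unit_frac1 D.
exists (fun k => map prodp (pieces k)); split=> [k|k|k l nkl|G [G0 irrG prodG]].
- split=> // [_ /mapP[X kX ->]|].
    rewrite -[prodp X]scale1r; apply/irredInt_prodp => //.
    exact: pieces_indecomposable kX.
  rewrite big_map (prod_set_count p (A := setT)) // => i.
  by rewrite count_pieces inE.
- by rewrite size_map /= size_map -cardE.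
- case=> eq_size [G' pG' kG'].
  (* The linear factor of a vertex [v] in block [k] has no associate in the factorization of [l]:
     the value at 1 makes the unit 1, the degree rules out [base l], and injectivity rules out the
     vertices of block [l]. *)
  have [v vk] := tag_surj k.
  have kv : [set Some v] \in pieces k.
    by rewrite inE map_f ?orbT // mem_enum inE vk.
  have ltj : (index [set Some v] (pieces k) < size (map prodp (pieces k)))%N.
    by rewrite size_map index_mem.
  have [u /unitIntP[x [_ ->]]] := kG' _ ltj.
  rewrite (nth_map set0) ?index_mem // nth_index // mul_polyC => def_v.
  set g := G'`_ _ in def_v.
  have : g \in map prodp (pieces l).
    by rewrite -(perm_mem pG') mem_nth // (perm_size pG') -eq_size.
  move=> /mapP[Y lY gY]; rewrite gY in def_v.
  have x1 : x = 1.
    have := congr1 (fun q : {poly {fraction D}} => q.[1]) def_v.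
    by rewrite hornerZ !prodp_at1 mulr1.
  move: lY def_v; rewrite x1 scale1r inE /prodp big_set1 => /orP[/eqP->|].
    move=> def_v; have := leq_size_prodp (None_base l).
    by rewrite /prodp -def_v size_p_Some leqNgt size_p_None.
  move=> /mapP[w lw ->]; rewrite big_set1 => /p_Some_inj vw.
  by move: lw nkl; rewrite mem_enum inE -vw vk => /eqP->; rewrite eqxx.
- have GD g : g \in G -> intD g by move/irrG=> [].
  have [|L [sL GL cntL]] := @factors_prodp G setT 1 u1 GD.
    by rewrite scale1r prodG.
  have indL X : X \in L -> indecomposable X.
    move=> LX; have ltj : (index X L < size G)%N by rewrite -sL index_mem.
    have [y [uy Gy]] := GL _ ltj; rewrite nth_index // in Gy.
    by apply/(irredInt_prodp _ uy); rewrite -Gy; apply: irrG; apply: mem_nth.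
  have [|k kL] := perm_pieces indL; first by move=> i; rewrite cntL inE.
  exists k; split; first by rewrite size_map -(perm_size kL).
  exists (map prodp L); first exact: perm_map.
  move=> j ltj; have [y [uy ->]] := GL j ltj.
  exists y%:P; first by apply/unitIntP; exists y.
  by rewrite (nth_map set0) ?sL // mul_polyC.
Qed.

End Factorizations.

(** * Construction of the polynomial whose divisibility by [c] detects vertex covers *)

Section Construction.
Variables (D : idomainType) (V : finType) (B : eqType) (tag : V -> B).
Implicit Types (J : {set V}) (d x y z : D).

(** Congruent to [d] modulo an ideal containing [b], and to 1 modulo an ideal containing [1 - b]. *)
Definition affine (b d : D) : D := b + (1 - b) * d.

Lemma dvd_ideal (c : D) : is_ideal (fun x => exists z, x = c * z).
Proof.
split; first by exists 0; rewrite mulr0.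
- by move=> _ _ [z ->] [w ->]; exists (z - w); rewrite mulrBr.
- by move=> a _ [z ->]; exists (a * z); rewrite mulrCA.
Qed.

(** Integrality of the quotient by [c] is phrased as divisibility of values, so that all congruences
    take place in [D]. *)
Lemma exists_cover_polynomial :
  dedekind D -> infinitely_many_maximal D ->
  (forall P : D -> Prop, maximal_ideal P -> finite_index P) -> inhabited V ->
  exists (c : D) (s : {poly D}) (b : V -> D),
    [/\ c != 0, irreducible_poly (map_poly (@FracField.tofrac D) s),
        (2 < size s)%N, s.[1] = c & [/\ injective b, forall v, b v != 1 &
    forall J,
      (forall d, exists e, s.[d] * \prod_(v in J) affine (b v) d = c * e) <->
      (forall v w, v \notin J -> w \notin J -> tag v = tag w)]].
Proof.
move=> dedD infD finD [v0]; have [noethD _ dimD] := dedD.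
(* [None] is for the Eisenstein ideal, [Some e] for the ideal of the ordered pair [e]. The diagonal
   pairs serve to separate the elements [b v] from each other and from 1. *)
pose I := option (V * V).
have [M [maxM distM]] := infD #|{: I}|.
pose P (i : I) := M (enum_rank i).
have maxP i : maximal_ideal (P i) by apply: maxM.
have distP i j : i != j -> ~ (forall x, P i x <-> P j x).
  by move=> nij; apply: distM; rewrite (inj_eq enum_rank_inj).
have idP i : is_ideal (P i) by case: (maxP i).
have prP i := maximal_ideal_prime (maxP i).
have P1 i : ~ P i 1 by case: (maxP i).
have oneB i x : P i (1 - x) -> ~ P i x.
  by move=> Px1 Px; apply: (P1 i); rewrite -(subrK x 1); apply: idealD.
have chin := maximal_ideal_chinese maxP distP.
have [L [L0 LP]] := finite_index_exponent maxP (fun i => finD _ (maxP i)).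
have [c [cP cR]] := chin [pred i : I | isSome i].
have [r [rR rP]] := chin [pred i : I | ~~ isSome i].
have {}cP e : P (Some e) c by apply: cP.
have {}cR : ~ P None c by apply: oneB; apply: cR.
have {}rR : P None r by apply: rR.
have {}rP e : ~ P (Some e) r by apply: oneB; apply: rP.
have nz i x : ~ P i x -> x != 0.
  by move=> nPx; apply/eqP => x0; apply: nPx; rewrite x0; apply: ideal0.
have r0 : r != 0 by apply: (nz (Some (v0, v0))).
have c0 : c != 0 by apply: (nz None).
have [|t [u unifR]] := uniformizer_exists dedD (maxP None); first by exists r.
have [Rt nRu uR] := unifR.
have [r' ur] := uR _ rR.
have t0 : t != 0.
  by apply: contraNneq (mulf_neq0 (nz _ _ nRu) r0) => t0; rewrite ur t0 mul0r.
have /choice[eps epsP] : forall e, exists a, ~ (exists z, a = c * z) /\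
    forall x, P (Some e) x -> exists z, a * x = c * z.
  by move=> e; apply: maximal_ideal_associated.
have /choice[b bP] : forall v, exists b, forall e,
    (v \in [:: e.1; e.2] -> P (Some e) b) /\
    (v \notin [:: e.1; e.2] -> P (Some e) (1 - b)).
  move=> v; have [b [bP nbP]] :=
    chin [pred i : I | if i is Some e then v \in [:: e.1; e.2] else false].
  by exists b => e; split=> ?; [apply: bP | apply: nbP].
(* The factor [r ^+ 2] puts [h] in the square of the Eisenstein ideal, yet [r] stays invertible
   modulo every [P (Some e)]. *)
pose h : D := r ^+ 2 * \sum_(e : V * V | tag e.1 != tag e.2) eps e.
(* The first summand vanishes modulo [c]; it supplies the leading coefficient [c] and the term
   [c * t] of the constant coefficient. Since [1 - d ^+ L] is 0 modulo [P (Some e)] for [d] outside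
   that ideal and 1 for [d] inside, the second carries the obstructions. At 1 only [c] survives. *)
pose s := c *: ('X^(L.+1) + t *: (1 - 'X)) + h *: (1 - 'X^L).
have coef_s i : s`_i = c * ((i == L.+1)%:R + t * ((i == 0%N)%:R - (i == 1%N)%:R))
    + h * ((i == 0%N)%:R - (i == L)%:R).
  by rewrite !(coefD, coefZ, coefB, coefXn, coefX, coef1, coefN).
have sM : s`_L.+1 = c.
  rewrite coef_s eqxx !eqSS !eqn0Ngt L0 /= gtn_eqF // !subr0 !mulr0 !addr0.
  by rewrite mulr1.
have size_s : size s = L.+2.
  apply/eqP; rewrite eqn_leq; apply/andP; split.
    apply/leq_sizeP => i ltLi; rewrite coef_s.
    do 4!(rewrite gtn_eqF; last by apply: leq_trans ltLi; rewrite ?ltnS).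
    by rewrite !subr0 !mulr0 !addr0 mulr0.
  by rewrite ltnNge; apply: contraNN c0 => /leq_sizeP/(_ L.+1 (leqnn _)); rewrite sM => ->.
have Rh : P None h by apply: idealMr => //; rewrite expr2; apply: idealMr.
exists c, s, b; split=> //.
- apply: (eisenstein noethD (maxP None) unifR _ size_s) => //.
  + by rewrite sM.
  + move=> i ltiL; rewrite coef_s ltn_eqF // add0r.
    by apply: idealD => //; [apply: idealMl => // |]; apply: idealMr.
  + move=> x y w /uR[x' ux] /uR[y' uy].
    have -> : s`_0 = c * t + h.
      by rewrite coef_s eqxx (ltn_eqF L0) /= !subr0 !mulr1 add0r.
    move=> wxy.
    (* Multiplying [w * (c * t + h) = x * y] by [u * u] makes the right side and the [h] term
       multiples of [t * t]; cancelling one [t] leaves a multiple of [t]. *)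
    have : P None (u * u * w * c).
      pose S := \sum_(e : V * V | tag e.1 != tag e.2) eps e.
      have xy' : t * t * (x' * y') = u * u * (w * (c * t + h)).
        by rewrite wxy mulrACA -ux -uy; ring.
      have h' : t * t * (w * r' ^+ 2 * S) = u * u * (w * h).
        have -> : t * t * (w * r' ^+ 2 * S) = w * (t * r') ^+ 2 * S by ring.
        by rewrite -ur /h -/S; ring.
      have -> : u * u * w * c = t * (x' * y' - w * r' ^+ 2 * S).
        by apply: (mulfI t0); rewrite [RHS]mulrA [RHS]mulrBr xy' h'; ring.
      by apply: idealMr.
    have [_ _ prR] := prP None.
    by move=> /prR[/prR[/prR[]|]|].
- by rewrite size_s.
- by rewrite !hornerE !expr1n !subrr !mulr0 !addr0 mulr1.
have s_at d : s.[d] = c * (d ^+ L.+1 + t * (1 - d)) + h * (1 - d ^+ L).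
  by rewrite !hornerE.
split=> [v w bvw|v|J].
- apply/eqP/contraT => nvw; case: (oneB (Some (v, v)) (b v)).
    by rewrite bvw; apply: (bP w (v, v)).2; rewrite !inE eq_sym (negPf nvw).
  by apply: (bP v (v, v)).1; rewrite !inE eqxx.
- apply/eqP => bv1; apply: (P1 (Some (v, v))); rewrite -bv1.
  by apply: (bP v (v, v)).1; rewrite !inE eqxx.
(* Modulo [c] the value at [d] is the sum of the obstructions [eps e], all with the same multiplier
   [y d]. *)
pose y d := r ^+ 2 * (1 - d ^+ L) * \prod_(v in J) affine (b v) d.
have sy d : s.[d] * \prod_(v in J) affine (b v) d =
    c * ((d ^+ L.+1 + t * (1 - d)) * \prod_(v in J) affine (b v) d)
    + \sum_(e : V * V | tag e.1 != tag e.2) eps e * y d.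
  by rewrite s_at -mulr_suml /y /h; ring.
have idc := dvd_ideal c.
split=> [dvdJ v w nJv nJw|coverJ d].
  apply/eqP/contraT => tvw; pose e0 := (v, w).
  (* [d] is 0 modulo the ideal of the uncovered edge [e0] and 1 modulo all others, which isolates
     the term of [e0]. *)
  have [d [d0 d1]] := chin (pred1 (Some e0)).
  have {}d0 : P (Some e0) d by apply: d0; rewrite /= eqxx.
  have [z dz] := dvdJ d.
  have [z' cz'] : exists z, eps e0 * y d = c * z.
    have : exists z, \sum_(e : V * V | tag e.1 != tag e.2) eps e * y d = c * z.
      apply: (idealDl idc (x := c * ((d ^+ L.+1 + t * (1 - d))
        * \prod_(v in J) affine (b v) d))); last by rewrite -sy; exists z.
      by eexists.
    rewrite (bigD1 e0) //= addrC; apply: (idealDl idc).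
    apply: (ideal_sum _ idc) => e /andP[_ ne0]; apply: (epsP e).2.
    apply: idealMr => //; apply: idealMl => //.
    rewrite -{1}[1](expr1n D L) subrXX; apply: idealMr => //; apply: d1.
    by apply: contraNneq ne0 => -[->].
  have nPy : ~ P (Some e0) (y d).
    have [_ _ pre] := prP (Some e0).
    move=> /pre[/pre[|]|].
    - by move/(prime_idealX (prP _)); apply: rP.
    - apply: oneB; rewrite opprB addrC subrK -(prednK L0) exprS.
      exact: idealMr.
    - apply: (prime_ideal_prod (prP _)) => x Jx; apply: oneB.
      have -> : 1 - affine (b x) d = (1 - b x) - (1 - b x) * d by rewrite /affine; ring.
      apply: idealB => //; last exact: idealMl.
      apply: (bP x e0).2; rewrite !inE negb_or.
      by apply/andP; split; apply: contraTneq Jx => ->.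
  (* As [y d] is invertible modulo [P (Some e0)], which kills [eps e0] modulo [c], divisibility of
     [eps e0 * y d] by [c] would pass to [eps e0]. *)
  have [a ay] := maximal_ideal_inv (maxP (Some e0)) nPy.
  case: (epsP e0) => + epse0; case.
  have -> : eps e0 = eps e0 * (1 - a * y d) + a * (eps e0 * y d) by ring.
  apply: (idealD idc); first exact: epse0.
  by rewrite cz'; apply: (idealMl _ idc); exists z'.
rewrite sy; apply: (idealD idc); first by eexists.
apply: (ideal_sum _ idc) => e te; apply: (epsP e).2.
(* Outside [P (Some e)] the factor [1 - d ^+ L] removes the obstruction; inside, the linear factor
   of an end of [e] in [J] does. *)
have [Pd|nPd] := pselect (P (Some e) d); last first.
  by apply: idealMr => //; apply: idealMl => //; apply: LP.
have [v Jv ve] : exists2 v, v \in J & v \in [:: e.1; e.2].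
  have [J1|nJ1] := boolP (e.1 \in J); first by exists e.1; rewrite ?inE ?eqxx.
  have [J2|nJ2] := boolP (e.2 \in J); first by exists e.2; rewrite ?inE ?eqxx ?orbT.
  by rewrite (coverJ _ _ nJ1 nJ2) eqxx in te.
rewrite /y (bigD1 v) //=; apply: idealMl => //; apply: idealMr => //.
by apply: idealD; [|apply: (bP v e).1 | apply: idealMl].
Qed.

End Construction.

(** * Assembly of the factors over the fraction field *)

Lemma irreducible_poly_scale (K : fieldType) (x : K) (q : {poly K}) :
  x != 0 -> irreducible_poly q -> irreducible_poly (x *: q).
Proof.
move=> x0 [lt1q irr_q]; split=> [|r r1]; first by rewrite size_scale.
rewrite dvdpZr // => /(irr_q r r1) rq.
by apply: (eqp_trans rq); rewrite eqp_sym eqp_scale.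
Qed.

Lemma irreducible_poly_size2 (K : fieldType) (q : {poly K}) :
  size q = 2%N -> irreducible_poly q.
Proof.
move=> q2; have q0 : q != 0 by rewrite -size_poly_eq0 q2.
split=> [|r r1 rq]; first by rewrite q2.
rewrite -dvdp_size_eqp // q2.
have := dvdp_leq q0 rq; rewrite q2.
have : r != 0 by apply: contraNneq q0 => r0; move: rq; rewrite r0 dvd0p.
rewrite -size_poly_gt0; move: r1; lia.
Qed.

Lemma card_tagged_fiber (n : nat) (m : 'I_n -> nat) (k : 'I_n) :
  #|[set v : {k : 'I_n & 'I_(m k)} | tag v == k]| = m k.
Proof.
have -> : [set v : {k : 'I_n & 'I_(m k)} | tag v == k] =
    [set Tagged (fun k => 'I_(m k)) i | i : 'I_(m k)].
  apply/setP=> -[l i]; rewrite inE /=.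
  apply/eqP/imsetP=> [lk|[j _ /(congr1 tag)] //].
  by case: k / lk; exists i.
rewrite card_imset ?card_ord // => i j eqij.
by have := eq_from_Tagged eqij.
Qed.

Theorem theorem4p1 (D : idomainType)
  (hD : dedekind D) (hinf : infinitely_many_maximal D)
  (hfin : forall P : D -> Prop, maximal_ideal P -> finite_index P)
  (n : nat) (m : 'I_n -> nat)
  (hn : (1 <= n)%N) (hm1 : forall i, (1 <= m i)%N)
  (hmono : forall i j : 'I_n, (i <= j)%N -> (m i <= m j)%N) :
  exists H : {poly {fraction D}}, intD H /\
    exists F : 'I_n -> seq {poly {fraction D}},
      [/\ forall i, factorizationInt H (F i),
          forall i, size (F i) = (m i).+1,
          forall i j, i != j -> ~ ess_same (F i) (F j) &
          forall G, factorizationInt H G -> exists i, ess_same G (F i)].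
Proof.
pose V : finType := {k : 'I_n & 'I_(m k)}; pose tagV (v : V) : 'I_n := tag v.
have tag_surj k : exists v, tagV v = k.
  by exists (Tagged (fun k => 'I_(m k)) (Ordinal (hm1 k))).
have [v0 _] := tag_surj (Ordinal hn).
have [c [s [b [c0 irr_s size_s s1 [b_inj b1 coverP]]]]] :=
  exists_cover_polynomial tagV hD hinf hfin (inhabits v0).
pose f v : {poly D} := (b v)%:P + (1 - b v) *: 'X.
have size_f v : size (f v) = 2%N.
  rewrite /f addrC size_polyDl size_scale ?size_polyX ?subr_eq0 1?eq_sym //.
  by rewrite ltnS size_polyC leq_b1.
have f_at v d : (f v).[d] = affine (b v) d by rewrite !hornerE.
have toF0 : (@FracField.tofrac D) 0 = 0 by rewrite tofrac0.
pose toF := map_poly (@FracField.tofrac D).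
have size_toF q : size (toF q) = size q.
  exact: (size_map_inj_poly (@tofrac_inj D)).
have toF_inj : injective toF by apply: map_inj_poly => //; apply: tofrac_inj.
have toF_at q d : (toF q).[FracField.tofrac d] = FracField.tofrac q.[d].
  exact: horner_map.
have c0' : (FracField.tofrac c)^-1 != 0 by rewrite invr_eq0 tofrac_eq0.
(* Division by [c] gives the nonlinear factor the value 1 at 1, as for the linear ones. *)
pose p (i : option V) := if i is Some v then toF (f v)
  else (FracField.tofrac c)^-1 *: toF s.
have p_at1 i : (p i).[1] = 1.
  rewrite -tofrac1; case: i => [v|] /=; rewrite ?hornerZ toF_at.
    by rewrite f_at /affine mulr1 addrC subrK.
  by rewrite s1 tofrac1 mulVf // tofrac_eq0.
have irr_p i : irreducible_poly (p i).
  case: i => [v|] /=; last exact: irreducible_poly_scale.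
  by apply: irreducible_poly_size2; rewrite size_toF.
have p_inj : injective (fun v => p (Some v)).
  move=> v w /toF_inj fvw; apply: b_inj; have := f_at v 0.
  by rewrite fvw f_at /affine !mulr0 !addr0.
have prodE (A : {set option V}) : prodp p A =
    (if None \in A then p None else 1) * toF (\prod_(v | Some v \in A) f v).
  rewrite /toF rmorph_prod /= -/toF /prodp; case: ifP => AN.
    rewrite (big_setD1 None) //=; congr (_ * _).
    by rewrite (reindex_omap Some id) => [|[]]; rewrite ?inE //;
       apply: eq_bigl => v; rewrite !inE eqxx andbT.
  rewrite mul1r (reindex_omap Some id) => [|[] //]; last by rewrite AN.
  by apply: eq_bigl => v; rewrite eqxx andbT.
(* Without [None] the coefficients lie in [D]; with it, integrality of the values is the
   divisibility by [c] in [coverP]. *)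
have intP (A : {set option V}) : intD (prodp p A) <-> covers tagV A.
  pose J := [set v | Some v \in A].
  have JE d : (\prod_(v | Some v \in A) f v).[d] = \prod_(v in J) affine (b v) d.
    rewrite horner_prod; apply: eq_big => [v|v _]; first by rewrite inE.
    exact: f_at.
  rewrite prodE /covers; case: ifP => AN; last first.
    split=> // _ d; exists (\prod_(v | Some v \in A) f v).[d].
    by rewrite mul1r toF_at.
  split=> [AD _ v w nAv nAw|covA d].
    apply: (coverP J).1; rewrite ?inE // => d; have [e Ade] := AD d.
    exists e; apply: tofrac_inj; rewrite !tofracM -Ade -JE hornerM hornerZ !toF_at.
    by rewrite -mulrA mulVKf // tofrac_eq0.
  have [|e de] := (coverP J).2 _ d.
    by move=> v w; rewrite !inE; apply: covA.
  exists e; rewrite hornerM hornerZ !toF_at -mulrA -tofracM JE de tofracM.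
  by rewrite mulKf // tofrac_eq0.
have size_p_None : (2 < size (p None))%N by rewrite /= size_scale // size_toF.
have size_p_Some v : size (p (Some v)) = 2%N by rewrite /= size_toF.
exists (prodp p setT); split; first by apply/intP => _ v w; rewrite inE.
have [F [F1 F2 F3 F4]] := exists_factorizations hn tag_surj irr_p p_at1
  size_p_None size_p_Some p_inj intP.
by exists F; split=> // k; rewrite F2 card_tagged_fiber.
Qed.
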